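(* Let $(X,r)$ be a finite solution of the YBE with $|X|=n$, and let $M=M(X,r)$ be its structure monoid. Then $M$ is Malcev nilpotent if and only if all cancellative subsemigroups of $M$ are Malcev nilpotent and, furthermore, the following Nilpotency Condition (NC) is NOT satisfied: (NC) there exist subsets $Y\neq Z$ of the generating set $\{a_1,\dotsc,a_n\}$ of $A(X,r)$ such that, among the generators $a_1,\dotsc,a_n$, the element $a_Y$ is divisible only by elements of $Y$ and the element $a_Z$ is divisible only by elements of $Z$, and there exist $a,b\in\langle Y\cap Z\rangle$ such that $\lambda'_b((\lambda'_a)^{-1}(Y))=Z$ and $\lambda'_b((\lambda'_a)^{-1}(Z))=Y$. Moreover, in this equivalence the requirement that all cancellative subsemigroups of $M$ be Malcev nilpotent may be replaced by the requirement that all the semigroups $m_YM_{YY}$, for non-empty $Y\subseteq\{a_1,\dotsc,a_n\}$ with $m_Y\notin M_{|Y|+1}$, be Malcev nilpotent.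
   Context: A solution of the YBE is a pair $(X,r)$ with $X$ a non-empty set and $r\colon X^2\to X^2$, $r(x,y)=(\lambda_x(y),\rho_y(x))$, a bijective map such that all $\lambda_x,\rho_y\colon X\to X$ are bijective and $(r\times\mathrm{id})(\mathrm{id}\times r)(r\times\mathrm{id})=(\mathrm{id}\times r)(r\times\mathrm{id})(\mathrm{id}\times r)$ on $X^3$. It is finite if $X$ is finite. Malcev nilpotency: for a semigroup $S$, $s,t\in S$ and $u_1,u_2,\dotsc\in S^1$ ($S^1$ is the smallest monoid containing $S$) put $x_0=s$, $y_0=t$, $x_{k+1}=x_ku_{k+1}y_k$, $y_{k+1}=y_ku_{k+1}x_k$. $S$ is Malcev nilpotent if there is $k\ge 0$ such that $x_k=y_k$ for all $s,t\in S$ and all $u_1,\dotsc,u_k\in S^1$. Structure monoids: write $X=\{x_1,\dotsc,x_n\}$. $M=M(X,r)$ is the monoid generated by $X$ with relations $x\circ y=\lambda_x(y)\circ\rho_y(x)$ ($x,y\in X$). $A=A(X,r)$ is the monoid (written additively, identity $0$) generated by $X$ with relations $x+\lambda_x(y)=\lambda_x(y)+\lambda_{\lambda_x(y)}(\rho_y(x))$; the generator of $A$ corresponding to $x_i$ is denoted $a_i$. There is a homomorphism $\lambda'\colon M\to\mathrm{Aut}(A,+)$, $m\mapsto\lambda'_m$, such that $\lambda'_x$ acts on the generators of $A$ as $\lambda_x$ for $x\in X$, and there is a unique bijective $1$-cocycle $\pi\colon M\to A$ with $\pi(x_i)=a_i$ and $\pi(m_1\circ m_2)=\pi(m_1)+\lambda'_{m_1}(\pi(m_2))$.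 For $a\in A$ write $\lambda'_a=\lambda'_{\pi^{-1}(a)}$. Via $m\mapsto(\pi(m),\lambda'_m)$ one identifies $M$ with the submonoid $\{(a,\lambda'_a):a\in A\}$ of $A\rtimes\mathrm{Im}(\lambda')$, with product $(a,\lambda'_a)(b,\lambda'_b)=(a+\lambda'_a(b),\lambda'_a\lambda'_b)$. Every $a\in A$ satisfies $a+A=A+a$; $b\in A$ divides $a$ (written $b\mid a$) if $a\in b+A$. $\langle Y\rangle$ is the submonoid of $A$ generated by $Y$. For $i\geq 0$ let $A_i$ be the set of $a\in A$ divisible by at least $i$ different generators amongst $a_1,\dotsc,a_n$ (so $A_{n+1}=\varnothing$), and $M_i=\{(a,\lambda'_a):a\in A_i\}$. There is an integer $d\geq 2$ such that $da$ is central in $A$ and $\lambda'_{da}=\mathrm{id}$ for all $a\in A$. For non-empty $Y\subseteq\{a_1,\dotsc,a_n\}$ put $a_Y=\sum_{y\in Y}dy\in A$ and $m_Y=(a_Y,\lambda'_{a_Y})=(a_Y,\mathrm{id})\in M$. Put $M_{YY}=\{(a,\lambda'_a): a\in A\setminus A_{|Y|+1},\ y\mid a\text{ for all }y\in Y,\ \lambda'_a(Y)=Y\}$. The integer $d$ is fixed and chosen (replacing it by a multiple if necessary) such that $m_YM_{YY}$ is a cancellative semigroup for each $Y$ with $a_Y\notin A_{|Y|+1}$. *)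

(* Defs.v *)
From HB Require Import structures.
From mathcomp Require Import all_boot.
From mathcomp Require Import boolp classical_sets.

Set Implicit Arguments.
Unset Strict Implicit.
Unset Printing Implicit Defensive.

Local Open Scope group_scope.

Section MalcevNilpotency.
Context {G : monoidType}.
Implicit Types S : set G.

(* The pair (x_k, y_k); the parameter written u_{k+1} in the usual
   presentation is [u k] here. *)
Fixpoint malcev_seq (s t : G) (u : nat -> G) (k : nat) : G * G :=
  if k is k'.+1 then
    let: (x, y) := malcev_seq s t u k' in (x * u k' * y, y * u k' * x)
  else (s, t).

(* S is a subsemigroup of the ambient monoid G, and S^1 is taken to be
   S together with the unit of G. If S happens to have an identity e of its
   own, then x * 1 * y = x * e * y for x, y in S, so allowing 1 as a parameter
   makes no difference. *)
Definition malcev_nilpotent S : Prop :=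
  exists k : nat, forall (s t : G) (u : nat -> G),
    S s -> S t -> (forall i, i < k -> S (u i) \/ u i = 1) ->
    (malcev_seq s t u k).1 = (malcev_seq s t u k).2.

Definition subsemigroup S : Prop := forall x y, S x -> S y -> S (x * y).

Definition submonoid S : Prop := S 1 /\ subsemigroup S.

Definition cancellative S : Prop :=
  forall a b c, S a -> S b -> S c ->
    (a * b = a * c -> b = c) /\ (b * a = c * a -> b = c).

Definition central (a : G) : Prop := forall c, a * c = c * a.

Definition divides (b a : G) : Prop := exists c, a = b * c.

End MalcevNilpotency.

(* The monoid with generators T and relations u = v for all words u, v such
   that R u v, as the quotient of the free monoid [seq T]. *)
Section PresentedMonoid.
Context {T : choiceType}.
Variable R : seq T -> seq T -> Prop.

Inductive pres_cong : seq T -> seq T -> Prop :=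
| pres_cong_rel u v : R u v -> pres_cong u v
| pres_cong_refl u : pres_cong u u
| pres_cong_sym u v : pres_cong u v -> pres_cong v u
| pres_cong_trans v u w : pres_cong u v -> pres_cong v w -> pres_cong u w
| pres_cong_cat u v u' v' :
    pres_cong u v -> pres_cong u' v' -> pres_cong (u ++ u') (v ++ v').

Definition pres_congb : rel (seq T) := fun u v => `[< pres_cong u v >].

Lemma pres_congb_refl : reflexive pres_congb.
Proof. by move=> u; apply/asboolP/pres_cong_refl. Qed.

Lemma pres_congb_sym : symmetric pres_congb.
Proof. by move=> u v; apply/asboolP/asboolP; apply: pres_cong_sym. Qed.

Lemma pres_congb_trans : transitive pres_congb.
Proof.
by move=> v u w /asboolP uv /asboolP vw; apply/asboolP/(pres_cong_trans uv).
Qed.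

Canonical pres_cong_equiv :=
  EquivRel pres_congb pres_congb_refl pres_congb_sym pres_congb_trans.

Definition presented_monoid := {eq_quot pres_cong_equiv}%qT.
HB.instance Definition _ := Choice.on presented_monoid.
HB.instance Definition _ := Quotient.on presented_monoid.

Definition word_class (w : seq T) : presented_monoid :=
  (\pi_presented_monoid w)%qT.

Lemma word_classP u v : word_class u = word_class v <-> pres_cong u v.
Proof.
split=> [/eqP|uv]; first by rewrite /word_class piE => /asboolP.
by apply/eqP; rewrite /word_class piE; apply/asboolP.
Qed.

Lemma word_class_repr (m : presented_monoid) : word_class (repr m) = m.
Proof. exact: reprK. Qed.

Lemma repr_word_class w : pres_cong (repr (word_class w)) w.
Proof. by apply/word_classP; rewrite word_class_repr. Qed.

Definition pres_mul (m n : presented_monoid) := word_class (repr m ++ repr n).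
Definition pres_one := word_class [::].

Lemma pres_mulE u v :
  pres_mul (word_class u) (word_class v) = word_class (u ++ v).
Proof. by apply/word_classP/pres_cong_cat; apply: repr_word_class. Qed.

Lemma pres_mulA : associative pres_mul.
Proof.
move=> a b c; rewrite -(word_class_repr a) -(word_class_repr b).
by rewrite -(word_class_repr c) !pres_mulE catA.
Qed.

Lemma pres_mul1g : left_id pres_one pres_mul.
Proof. by move=> a; rewrite -(word_class_repr a) pres_mulE. Qed.

Lemma pres_mulg1 : right_id pres_one pres_mul.
Proof. by move=> a; rewrite -(word_class_repr a) pres_mulE cats0. Qed.

HB.instance Definition _ :=
  isMonoid.Build presented_monoid pres_mulA pres_mul1g pres_mulg1.

Lemma word_class_cat u v : word_class (u ++ v) = word_class u * word_class v.
Proof. by rewrite -pres_mulE. Qed.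

Lemma word_class_nil : word_class [::] = 1. Proof. by []. Qed.

Definition pres_gen (x : T) : presented_monoid := word_class [:: x].

End PresentedMonoid.

Definition map12 (X : Type) (r : X * X -> X * X) (t : X * X * X) : X * X * X :=
  let: (x, y, z) := t in ((r (x, y)).1, (r (x, y)).2, z).

Definition map23 (X : Type) (r : X * X -> X * X) (t : X * X * X) : X * X * X :=
  let: (x, y, z) := t in (x, (r (y, z)).1, (r (y, z)).2).

Record ybe_solution (X : finType) := YBESolution {
  ybe_map :> X * X -> X * X;
  ybe_nonempty : (0 < #|X|)%N;
  ybe_map_bij : bijective ybe_map;
  ybe_lam_bij : forall x, bijective (fun y => (ybe_map (x, y)).1);
  ybe_rho_bij : forall y, bijective (fun x => (ybe_map (x, y)).2);
  ybe_braid : forall t,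
    map12 ybe_map (map23 ybe_map (map12 ybe_map t)) =
    map23 ybe_map (map12 ybe_map (map23 ybe_map t)) }.

Section StructureMonoids.
Context {X : finType}.
Variable s : ybe_solution X.

Definition lam (x y : X) : X := (s (x, y)).1.
Definition rho (y x : X) : X := (s (x, y)).2.

Definition structure_rel (u v : seq X) : Prop :=
  exists x y, u = [:: x; y] /\ v = [:: lam x y; rho y x].

Definition derived_rel (u v : seq X) : Prop :=
  exists x y, u = [:: x; lam x y] /\
              v = [:: lam x y; lam (lam x y) (rho y x)].

(* M(X,r) and A(X,r). The monoid A is not commutative in general, so it is
   written multiplicatively here: a + b, 0 and d a become a * b, 1 and a ^+ d. *)
Definition structure_monoid := presented_monoid structure_rel.
Definition derived_monoid := presented_monoid derived_rel.
HB.instance Definition _ := monoid.Monoid.on structure_monoid.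
HB.instance Definition _ := monoid.Monoid.on derived_monoid.

Implicit Types (m : structure_monoid) (a b c : derived_monoid).
Implicit Types (x y z : X) (u v w : seq X) (Y Z : {set X}).

Definition Mgen x : structure_monoid := pres_gen structure_rel x.
Definition Agen x : derived_monoid := pres_gen derived_rel x.

Definition lam_word w : X -> X := foldr (fun x f => lam x \o f) id w.

(* The permutation of X (the index set of the generators of A) induced by
   lambda'_m, and lambda'_m itself; see [lamA_gen], [lamAM], [lamA1],
   [lamA_mul], [lamA_one] and [lamA_bij]. *)
Definition lamX m : X -> X := lam_word (repr m).
Definition lamA m a : derived_monoid :=
  word_class derived_rel (map (lamX m) (repr a)).

(* x_1 o ... o x_k |-> x_1 + lam_{x_1}(x_2) + lam_{x_1} lam_{x_2}(x_3) + ... and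
   its inverse; [f] accumulates lam_{x_1} ... lam_{x_i}. *)
Fixpoint cocycle_word (f : X -> X) w : seq X :=
  if w is x :: w' then f x :: cocycle_word (f \o lam x) w' else [::].
Fixpoint cocycle_inv_word (f : X -> X) w : seq X :=
  if w is y :: w' then
    finv f y :: cocycle_inv_word (f \o lam (finv f y)) w'
  else [::].

(* The bijective 1-cocycle pi : M -> A and its inverse; see [cocycle_gen],
   [cocycle_mul], [cocycleK] and [cocycle_invK]. *)
Definition cocycle m : derived_monoid :=
  word_class derived_rel (cocycle_word id (repr m)).
Definition cocycle_inv a : structure_monoid :=
  word_class structure_rel (cocycle_inv_word id (repr a)).

Lemma lam_inj x : injective (lam x).
Proof. exact: bij_inj (ybe_lam_bij s x). Qed.

Lemma lam_lam x y z : lam x (lam y z) = lam (lam x y) (lam (rho y x) z).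
Proof. by case: (ybe_braid s (x, y, z)) => e1 _ _; rewrite /lam /rho e1. Qed.

Lemma lam_rho x y z :
  lam (rho (lam y z) x) (rho z y) = rho (lam (rho y x) z) (lam x y).
Proof. by case: (ybe_braid s (x, y, z)) => _ e2 _; rewrite /lam /rho e2. Qed.

(* [lam z] permutes the defining relations of A. *)
Lemma lam_derived z x y :
  lam z (lam (lam x y) (rho y x)) =
  lam (lam (lam z x) (lam (rho x z) y))
      (rho (lam (rho x z) y) (lam z x)).
Proof.
by rewrite lam_lam lam_rho -lam_lam.
Qed.

Lemma lam_word_inj w : injective (lam_word w).
Proof. by elim: w => [|x w IH] //=; apply: inj_comp IH; apply: lam_inj. Qed.

Lemma lam_word_cat u v : lam_word (u ++ v) =1 lam_word u \o lam_word v.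
Proof. by elim: u => [|x u IH] z //=; rewrite IH. Qed.

Lemma lam_word_cong u v :
  pres_cong structure_rel u v -> lam_word u =1 lam_word v.
Proof.
elim=> {u v} [u v [x [y [-> ->]]]|u|u v _ IH|v u w _ IH1 _ IH2|].
- by move=> z /=; rewrite lam_lam.
- by [].
- by move=> z; rewrite IH.
- by move=> z; rewrite IH1 IH2.
by move=> u v u' v' _ IH1 _ IH2 z; rewrite !lam_word_cat /= IH1 IH2.
Qed.

Lemma lamX_word w : lamX (word_class structure_rel w) =1 lam_word w.
Proof. exact/lam_word_cong/repr_word_class. Qed.

Lemma lamX_gen x : lamX (Mgen x) =1 lam x.
Proof. exact: lamX_word. Qed.

Lemma lamX_mul m n : lamX (m * n) =1 lamX m \o lamX n.
Proof.
move=> z; rewrite -[m]word_class_repr -[n]word_class_repr -word_class_cat.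
by rewrite lamX_word lam_word_cat /= !lamX_word.
Qed.

Lemma lamX_one : lamX 1 =1 id.
Proof. exact: lamX_word. Qed.

Lemma lamX_inj m : injective (lamX m).
Proof. exact: lam_word_inj. Qed.

(* [f] respects the defining relations of A. *)
Definition derived_compat (f : X -> X) := forall x y, exists y',
  f (lam x y) = lam (f x) y' /\
  f (lam (lam x y) (rho y x)) = lam (lam (f x) y') (rho y' (f x)).

Lemma lam_word_compat w : derived_compat (lam_word w).
Proof.
elim: w => [|z w IH] x y /=; first by exists y.
have [y' [-> ->]] := IH x y; exists (lam (rho (lam_word w x) z) y').
by split; [apply: lam_lam | apply: lam_derived].
Qed.

Lemma map_compat_cong f u v : derived_compat f ->
  pres_cong derived_rel u v -> pres_cong derived_rel (map f u) (map f v).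
Proof.
move=> fP; elim=> {u v} [u v [x [y [-> ->]]]|u|u v _ IH|v u w _ IH1 _ IH2|].
- have [y' [/= -> ->]] := fP x y; apply: pres_cong_rel; by exists (f x), y'.
- exact: pres_cong_refl.
- exact: pres_cong_sym.
- exact: pres_cong_trans IH2.
by move=> u v u' v' _ IH1 _ IH2; rewrite !map_cat; apply: pres_cong_cat.
Qed.

Lemma lamA_word m w :
  lamA m (word_class derived_rel w) = word_class derived_rel (map (lamX m) w).
Proof.
apply/word_classP/map_compat_cong; first exact: lam_word_compat.
exact: repr_word_class.
Qed.

Lemma lamA_gen m x : lamA m (Agen x) = Agen (lamX m x).
Proof. exact: lamA_word. Qed.

Lemma lamAM m a b : lamA m (a * b) = lamA m a * lamA m b.
Proof.
rewrite -[a]word_class_repr -[b]word_class_repr -word_class_cat.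
by rewrite !lamA_word map_cat word_class_cat.
Qed.

Lemma lamA1 m : lamA m 1 = 1.
Proof. exact: lamA_word. Qed.

Lemma lamA_mul m n a : lamA (m * n) a = lamA m (lamA n a).
Proof.
rewrite -[a]word_class_repr !lamA_word -map_comp.
by congr word_class; apply/eq_map/lamX_mul.
Qed.

Lemma lamA_one a : lamA 1 a = a.
Proof.
rewrite -[a]word_class_repr lamA_word (eq_map lamX_one).
by rewrite map_id.
Qed.

Lemma lam_word_nseq w k : lam_word (flatten (nseq k w)) =1 iter k (lam_word w).
Proof. by elim: k => [|k IH] z //=; rewrite lam_word_cat /= IH. Qed.

Lemma lamA_bij m : bijective (lamA m).
Proof.
pose p : structure_monoid := word_class _
  (flatten (nseq (\prod_(x : X) order (lamX m) x)%N.-1 (repr m))).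
have N_gt0 : (0 < \prod_(x : X) order (lamX m) x)%N.
  by apply: prodn_gt0 => x; apply: order_gt0.
have iterN : iter (\prod_(x : X) order (lamX m) x)%N (lamX m) =1 id.
  move=> x; rewrite (bigD1 x) //=; set q := (\prod_(_ | _) _)%N.
  elim: q => [|q IH]; first by rewrite muln0.
  by rewrite mulnS iterD IH iter_order //; apply: lamX_inj.
have pX : lamX p =1 iter (\prod_(x : X) order (lamX m) x)%N.-1 (lamX m).
  by move=> z; rewrite lamX_word lam_word_nseq.
exists (lamA p) => a; rewrite -[a]word_class_repr !lamA_word -map_comp.
  congr word_class; rewrite -[RHS]map_id; apply: eq_map => z /=.
  by rewrite pX -iterSr prednK.
congr word_class; rewrite -[RHS]map_id; apply: eq_map => z /=.
by rewrite pX -iterS prednK.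
Qed.

Lemma eq_cocycle_word f g : f =1 g -> cocycle_word f =1 cocycle_word g.
Proof.
move=> fg w; elim: w f g fg => [|x w IH] f g fg //=.
by rewrite fg; congr (_ :: _); apply: IH => z /=.
Qed.

Lemma cocycle_word_cat f u v :
  cocycle_word f (u ++ v) = cocycle_word f u ++ cocycle_word (f \o lam_word u) v.
Proof.
elim: u f => [|x u IH] f; first exact: eq_cocycle_word.
by rewrite /= IH; congr (_ :: _ ++ _).
Qed.

Lemma map_cocycle_word f g w :
  map g (cocycle_word f w) = cocycle_word (g \o f) w.
Proof. by elim: w f => [|x w IH] f //=; rewrite IH. Qed.

Lemma cocycle_word_cong u v : pres_cong structure_rel u v ->
  pres_cong derived_rel (cocycle_word id u) (cocycle_word id v).
Proof.
elim=> {u v} [u v [x [y [-> ->]]]|u|u v _ IH|v u w _ IH1 _ IH2|].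
- by apply: pres_cong_rel; exists x, y.
- exact: pres_cong_refl.
- exact: pres_cong_sym.
- exact: pres_cong_trans IH2.
move=> u v u' v' uv IH1 _ IH2; rewrite !cocycle_word_cat.
apply: pres_cong_cat => //.
have E (w t : seq X) : cocycle_word (id \o lam_word w) t
    = map (lam_word w) (cocycle_word id t).
  by rewrite map_cocycle_word.
rewrite !E -(eq_map (lam_word_cong uv)).
by apply: map_compat_cong => //; apply: lam_word_compat.
Qed.

Lemma cocycle_word_class w :
  cocycle (word_class structure_rel w) =
  word_class derived_rel (cocycle_word id w).
Proof. exact/word_classP/cocycle_word_cong/repr_word_class. Qed.

Lemma cocycle_gen x : cocycle (Mgen x) = Agen x.
Proof. exact: cocycle_word_class. Qed.

Lemma cocycle_mul m n : cocycle (m * n) = cocycle m * lamA m (cocycle n).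
Proof.
rewrite -[m]word_class_repr -[n]word_class_repr -word_class_cat.
rewrite !cocycle_word_class lamA_word -word_class_cat cocycle_word_cat.
rewrite (eq_map (lamX_word _)) map_cocycle_word.
by congr (word_class _ (_ ++ _)); apply: eq_cocycle_word.
Qed.

Lemma cocycle_wordK f : injective f ->
  cancel (cocycle_word f) (cocycle_inv_word f).
Proof.
move=> f_inj w; elim: w f f_inj => [|x w IH] f f_inj //=.
rewrite finv_f //; congr (_ :: _); apply: IH.
exact: inj_comp (lam_inj (x := x)).
Qed.

Lemma cocycle_inv_wordK f : injective f ->
  cancel (cocycle_inv_word f) (cocycle_word f).
Proof.
move=> f_inj w; elim: w f f_inj => [|y w IH] f f_inj //=.
rewrite f_finv //; congr (_ :: _); apply: IH.
exact: inj_comp (lam_inj (x := _)).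
Qed.

Lemma cocycle_inv_word_cat f u v : injective f ->
  cocycle_inv_word f (u ++ v) = cocycle_inv_word f u
    ++ cocycle_inv_word (f \o lam_word (cocycle_inv_word f u)) v.
Proof.
move=> f_inj; elim: u f f_inj => [|y u IH] f f_inj //=.
by rewrite IH //; apply: inj_comp (lam_inj (x := _)).
Qed.

Lemma eq_cocycle_inv_word f g : injective f -> f =1 g ->
  cocycle_inv_word f =1 cocycle_inv_word g.
Proof.
move=> f_inj fg w.
have g_inj : injective g by move=> x y; rewrite -!fg => /f_inj.
apply: (can_inj (cocycle_wordK f_inj)).
by rewrite cocycle_inv_wordK // (eq_cocycle_word fg) cocycle_inv_wordK.
Qed.

Lemma cocycle_inv_word_cong u v p : pres_cong derived_rel u v ->
  pres_cong structure_rel (cocycle_inv_word (lam_word p) u)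
                          (cocycle_inv_word (lam_word p) v).
Proof.
move=> uv; elim: uv p => {u v}.
- move=> u v [x [y [-> ->]]] p /=.
  set f := lam_word p; have f_inj : injective f by apply: lam_word_inj.
  set x' := finv f x; have fx' : f x' = x by rewrite f_finv.
  set y' := finv _ (lam x y).
  have fy' : f (lam x' y') = lam x y.
    by rewrite -[LHS]/((f \o lam x') y') f_finv //; apply: inj_comp (@lam_inj _).
  have -> : finv f (lam x y) = lam x' y' by rewrite -fy' finv_f.
  apply: pres_cong_rel; exists x', y'; split=> //; congr [:: _; _].
  have [y2 [e1 e2]] := lam_word_compat p x' y'.
  rewrite -/f fx' fy' in e1 e2; have y2E : y2 = y := esym (lam_inj e1).
  rewrite y2E in e2; rewrite -e2 -[f _]/((f \o lam (lam x' y')) _) finv_f //.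
  exact: inj_comp (@lam_inj _).
- by move=> u p; apply: pres_cong_refl.
- by move=> u v _ IH p; apply: pres_cong_sym.
- by move=> v u w _ IH1 _ IH2 p; apply: pres_cong_trans (IH1 p) (IH2 p).
move=> u v u' v' _ IH1 _ IH2 p.
rewrite !cocycle_inv_word_cat; try exact: lam_word_inj.
apply: pres_cong_cat => //.
have E (w t : seq X) : cocycle_inv_word (lam_word p \o lam_word w) t =
    cocycle_inv_word (lam_word (p ++ w)) t.
  apply: eq_cocycle_inv_word => [|z]; last by rewrite lam_word_cat.
  by apply: inj_comp; apply: lam_word_inj.
rewrite !E; apply: pres_cong_trans (IH2 _) _.
rewrite -!E.
rewrite (@eq_cocycle_inv_word _ (lam_word p \o
  lam_word (cocycle_inv_word (lam_word p) v))).
- exact: pres_cong_refl.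
- by apply: inj_comp; apply: lam_word_inj.
by move=> t /=; rewrite (lam_word_cong (IH1 p)).
Qed.

Lemma cocycle_inv_word_class w :
  cocycle_inv (word_class derived_rel w) =
  word_class structure_rel (cocycle_inv_word id w).
Proof.
exact/word_classP/(@cocycle_inv_word_cong _ _ [::])/repr_word_class.
Qed.

Lemma cocycleK : cancel cocycle cocycle_inv.
Proof.
move=> m; rewrite -[m]word_class_repr cocycle_word_class.
by rewrite cocycle_inv_word_class cocycle_wordK.
Qed.

Lemma cocycle_invK : cancel cocycle_inv cocycle.
Proof.
move=> a; rewrite -[a]word_class_repr cocycle_inv_word_class.
by rewrite cocycle_word_class cocycle_inv_wordK.
Qed.

Lemma derived_cong_size u v : pres_cong derived_rel u v ->
  size u = size v /\ ((size u <= 1)%N -> u = v).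
Proof.
elim=> {u v} [u v [x [y [-> ->]]]|u|u v _ [e1 e2]|v u w _ [e1 e2] _ [e3 e4]|] //.
- by split=> // uv; rewrite e2 // e1.
- by rewrite -e3 e1; split=> // uv; rewrite e2 ?e1 // e4.
move=> u v u' v' _ [e1 e2] _ [e3 e4].
split=> [|uv]; first by rewrite !size_cat e1 e3.
rewrite size_cat in uv; congr (_ ++ _).
  exact: e2 (leq_trans (leq_addr _ _) uv).
exact: e4 (leq_trans (leq_addl _ _) uv).
Qed.

Lemma Agen_inj : injective Agen.
Proof.
by move=> x y /word_classP/derived_cong_size[_ /(_ isT)]; case.
Qed.

(* lambda'_a for a in A, as a permutation of X and as an automorphism of A. *)
Definition lamX_of a : X -> X := lamX (cocycle_inv a).
Definition lamA_of a : derived_monoid -> derived_monoid := lamA (cocycle_inv a).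

Definition gen_divisors a : {set X} := [set x | `[< divides (Agen x) a >]]%SET.

(* A_i and M_i. By [Agen_inj], distinct indices are distinct generators. *)
Definition A_ge (i : nat) : set derived_monoid :=
  (fun a => (i <= #|gen_divisors a|)%N).
Definition M_ge (i : nat) : set structure_monoid := (fun m => A_ge i (cocycle m)).

(* A subset {a_y : y in Y} of the generators of A is given by its index set Y. *)
Definition gen_submonoid Y : set derived_monoid :=
  smallest submonoid (fun a => exists2 y, y \in Y & a = Agen y).

Section Exponent.
Variable d : nat.

(* a_Y and m_Y, meant for d such that every d a is central, so that the order
   of the factors is irrelevant. *)
Definition aY Y : derived_monoid := \prod_(y in Y) Agen y ^+ d.
Definition mY Y : structure_monoid := cocycle_inv (aY Y).

(* M is identified with {(a, lambda'_a)} by m |-> (cocycle m, lamA m). *)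
Definition MYY Y : set structure_monoid := fun m =>
  [/\ ~ A_ge #|Y|.+1 (cocycle m),
      forall y, y \in Y -> divides (Agen y) (cocycle m)
    & lamX_of (cocycle m) @: Y = Y].

Definition mY_MYY Y : set structure_monoid :=
  fun p => exists2 m, MYY Y m & p = mY Y * m.

Definition admissible_exponent : Prop :=
  [/\ (2 <= d)%N,
      forall a, central (a ^+ d),
      forall a, lamA_of (a ^+ d) =1 id
    & forall Y, Y != finset.set0 -> ~ A_ge #|Y|.+1 (aY Y) ->
        subsemigroup (mY_MYY Y) /\ cancellative (mY_MYY Y)].

(* For Y = Z = set0 (where aY set0 = 1) the last two conditions force Y = Z, so
   Y and Z are necessarily non-empty. *)
Definition nilpotency_condition : Prop :=
  exists Y Z : {set X},
    [/\ Y <> Z,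
        forall x, divides (Agen x) (aY Y) -> x \in Y,
        forall x, divides (Agen x) (aY Z) -> x \in Z
      & exists a b, [/\ gen_submonoid (Y :&: Z) a, gen_submonoid (Y :&: Z) b,
          lamX_of b @: (lamX_of a @^-1: Y) = Z
        & lamX_of b @: (lamX_of a @^-1: Z) = Y]].

End Exponent.
End StructureMonoids.

Arguments A_ge {X} s i _.
Arguments M_ge {X} s i _.
Arguments gen_submonoid {X} s Y _.
Arguments MYY {X} s Y _.
Arguments mY_MYY {X} s d Y _.

(* Main.v *)
(* Write D x for the set of generators dividing the A-component of x in M; it is
   the set of letters of all words representing that component. Along a Malcev
   sequence |D x_k| and |D y_k| cannot decrease, so it is enough to study
   sequences on which D x_k = Y and D y_k = Z are constant, with |Y| = |Z|. Each
   step then appends a full copy of Y, hence x_k becomes divisible by any given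
   power of m_Y, and a_Y is divisible by Y only.
   If Y <> Z, the permutations induced by u_1 and u_2 carry Y and Z to the same
   two sets in opposite ways; inverting them inside <Y :&: Z> gives (NC).
   Conversely the elements a, b of (NC) provide parameters for which D x_k = Y
   and D y_k = Z for all k.
   If Y = Z, all right supports lambda_{x_k}^-1(Y) equal one set R. Choose h with
   lambda_h(Y) = R, and h' with h h' = m_R^J and h' h = m_Y^J. Then the x_k h lie
   in M_YY, and
     (x_k h) (h' u_{k+1}) (y_k h) = m_Y^J x_{k+1} h,
   so that up to powers of m_Y they form a Malcev sequence in m_Y M_YY. Since
   there are finitely many pairs (Y, R), J can be bounded uniformly, and
   cancelling in m_Y M_YY gives x_k = y_k as soon as m_Y^(J+2) divides both. *)

Require Import Defs.
From mathcomp Require Import all_boot.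
From mathcomp Require Import boolp classical_sets.
From mathcomp Require Import zify.

Set Implicit Arguments.
Unset Strict Implicit.
Unset Printing Implicit Defensive.

Local Open Scope group_scope.

(** * Uniform bounds, central products and Malcev sequences *)

Lemma finite_uniform_bound (T : finType) (P : T -> nat -> Prop) :
  (forall t k l, (k <= l)%N -> P t k -> P t l) ->
  (forall t, exists k, P t k) -> exists k, forall t, P t k.
Proof.
move=> mono /choice[f fP]; exists (\max_t f t)%N => t.
exact: mono (leq_bigmax _) (fP t).
Qed.

Section Monoid.
Context {G : monoidType}.
Implicit Types (a b c s t : G) (u : nat -> G) (S : set G).

Lemma central_mul a b : central a -> central b -> central (a * b).
Proof. by move=> ca cb c; rewrite -mulgA cb !mulgA ca. Qed.

Lemma central_one : central (1 : G).
Proof. by move=> c; rewrite mul1g mulg1. Qed.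

Lemma prod_central (I : Type) (r : seq I) (F : I -> G) :
  (forall i, central (F i)) -> central (\prod_(i <- r) F i).
Proof.
move=> cF; elim/big_ind: _ => // [|a b]; first exact: central_one.
exact: central_mul.
Qed.

(** Even in a noncommutative [G], a central factor can be moved to the front, which suffices for any
    reordering. *)
Lemma perm_prod_central (I : eqType) (r r' : seq I) (F : I -> G) :
  (forall i, central (F i)) -> perm_eq r r' ->
  \prod_(i <- r) F i = \prod_(i <- r') F i.
Proof.
move=> cF; elim: r r' => [|i r IH] r'; first by rewrite perm_sym => /perm_nilP->.
move=> rr'; have ir' : i \in r' by rewrite -(perm_mem rr') mem_head.
case/splitPr: r' / ir' rr' => r1 r2 rr'.
rewrite big_cons (IH (r1 ++ r2)) ?big_cat ?big_cons /= ?mulgA ?cF //.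
by rewrite -(perm_cons i) (permPl rr') perm_catC /= perm_cons perm_catC.
Qed.

Lemma divides_trans b a c : divides a b -> divides b c -> divides a c.
Proof. by move=> [c1 ->] [c2 ->]; exists (c1 * c2); rewrite mulgA. Qed.

Lemma divides_mulr a b c : divides a b -> divides a (b * c).
Proof. by move=> [c1 ->]; exists (c1 * c); rewrite mulgA. Qed.

Lemma malcev_seqD s t u k l :
  malcev_seq s t u (k + l) =
  malcev_seq (malcev_seq s t u k).1 (malcev_seq s t u k).2
    (fun i => u (k + i)%N) l.
Proof.
elim: l => [|l IH]; first by rewrite addn0; case: malcev_seq.
by rewrite addnS /= IH.
Qed.

Lemma malcev_seq_eq s t u k l : (k <= l)%N ->
  (malcev_seq s t u k).1 = (malcev_seq s t u k).2 ->
  (malcev_seq s t u l).1 = (malcev_seq s t u l).2.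
Proof.
move=> /subnKC <-; rewrite malcev_seqD; move: (l - k)%N => {}l.
case: (malcev_seq s t u k) => x _ /= <-.
by elim: l => //= l; case: malcev_seq => y z /= ->.
Qed.

Lemma malcev_nilpotent_sub S S' :
  (forall x, S x -> S' x) -> malcev_nilpotent S' -> malcev_nilpotent S.
Proof.
move=> SS' [k kP]; exists k => s t u /SS' Ss /SS' St uP; apply: kP => // i ik.
by case: (uP i ik) => [/SS'|]; [left|right].
Qed.

End Monoid.

(** * Divisibility by generators in A *)

Section Derived.
Import fintype mathcomp.boot.finset.
Context {X : finType} (s : ybe_solution X).
Notation A := (derived_monoid s).
Notation M := (structure_monoid s).
Implicit Types (x y z : X) (w : seq X) (Y Z R : {set X}).
Implicit Types (a b c : A) (m h : M).

(* Chosen so that x + z = z + sig z x is a defining relation of A. *)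
Definition sig z x : X := lam s z (rho s (finv (lam s x) z) x).

(** The solution sends the pair [(x, finv (lam s x) z)] to a pair with first component [z], whose
    second component is determined by [sig z x]; bijectivity of the solution then recovers [x]. *)
Lemma sig_inj z : injective (sig z).
Proof.
move=> x x' /lam_inj e; have := bij_inj (ybe_map_bij s).
move=> /(_ (x, finv (lam s x) z) (x', finv (lam s x') z)).
have E x1 : s (x1, finv (lam s x1) z) = (z, rho s (finv (lam s x1) z) x1).
  by rewrite [LHS]surjective_pairing; congr pair; apply: (f_finv (@lam_inj _ s x1)).
by rewrite !E e => /(_ erefl)[].
Qed.

Lemma derived_relE u v :
  derived_rel s u v -> exists x z, u = [:: x; z] /\ v = [:: z; sig z x].
Proof.
move=> [x [y [-> ->]]]; exists x, (lam s x y); split=> //.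
by rewrite /sig finv_f //; apply: lam_inj.
Qed.

Lemma Agen_sig x z : Agen s x * Agen s z = Agen s z * Agen s (sig z x).
Proof.
rewrite -[LHS]word_class_cat -[RHS]word_class_cat.
apply/word_classP/pres_cong_rel; exists x, (finv (lam s x) z).
by rewrite (f_finv (@lam_inj _ s x)).
Qed.

Lemma word_class_cons x w :
  word_class (derived_rel s) (x :: w) = Agen s x * word_class (derived_rel s) w.
Proof. exact: (@word_class_cat _ _ [:: x]). Qed.

(** [Agen_sig] moves one generator leftwards through any word; induction on a word for [b] does the
    rest. Consequently a divisor of either factor divides a product. *)
Lemma mul_swap a b : exists a' : A, a * b = b * a'.
Proof.
have gen_swap c x : exists c' : A, c * Agen s x = Agen s x * c'.
  rewrite -[c]word_class_repr; elim: (repr c) => [|z w [c' IH]].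
    by exists 1; rewrite word_class_nil mul1g mulg1.
  exists (Agen s (sig x z) * c').
  by rewrite word_class_cons -mulgA IH !mulgA Agen_sig.
rewrite -[b]word_class_repr; elim: (repr b) a => [|z w IH] a.
  by exists a; rewrite word_class_nil mul1g mulg1.
have [a1 e1] := gen_swap a z; have [a2 e2] := IH a1; exists a2.
by rewrite word_class_cons mulgA e1 -mulgA e2 mulgA.
Qed.

Lemma divides_mull a b c : divides a c -> divides a (b * c).
Proof.
move=> [u ->]; have [b' e] := mul_swap b a; exists (b' * u).
by rewrite mulgA e mulgA.
Qed.

Lemma divides_mul a b c e :
  divides a b -> divides c e -> divides (a * c) (b * e).
Proof.
move=> [u ->] [v ->]; have [u' e'] := mul_swap u c; exists (u' * v).
by rewrite !mulgA; congr (_ * _); rewrite -!mulgA e'.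
Qed.

Lemma gen_divisorsP x a : reflect (divides (Agen s x) a) (x \in gen_divisors a).
Proof. by rewrite inE; apply: asboolP. Qed.

Lemma gen_divisors_mul a b :
  gen_divisors a :|: gen_divisors b \subset gen_divisors (a * b).
Proof.
by apply/subsetP=> x /setUP[] /gen_divisorsP D; apply/gen_divisorsP;
  [apply: divides_mulr | apply: divides_mull].
Qed.

Lemma gen_divisors_mull a b : gen_divisors a \subset gen_divisors (a * b).
Proof. exact: subset_trans (subsetUl _ _) (gen_divisors_mul a b). Qed.

Lemma gen_divisors_mulr a b : gen_divisors b \subset gen_divisors (a * b).
Proof. exact: subset_trans (subsetUr _ _) (gen_divisors_mul a b). Qed.

Lemma gen_divisors_word x w :
  x \in w -> x \in gen_divisors (word_class (derived_rel s) w).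
Proof.
elim: w => // z w IH; rewrite inE word_class_cons => /predU1P[->|/IH xw].
  by apply/gen_divisorsP; exists (word_class _ w).
exact: (subsetP (gen_divisors_mulr _ _)).
Qed.

Lemma repr_gen_divisors x a : x \in repr a -> x \in gen_divisors a.
Proof. by move=> /gen_divisors_word; rewrite word_class_repr. Qed.

Lemma gen_divisors0 a : gen_divisors a = set0%SET -> a = 1.
Proof.
move=> D0; rewrite -[a]word_class_repr; case E: (repr a) => [//|x w].
by have := @repr_gen_divisors x a; rewrite E D0 mem_head inE => /(_ isT).
Qed.

Lemma lamA_inj m : injective (lamA m).
Proof. exact: bij_inj (lamA_bij m). Qed.

Lemma gen_divisors_lamA m a : gen_divisors (lamA m a) = lamX m @: gen_divisors a.
Proof.
have [g gK Kg] := lamA_bij m.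
apply/setP=> x; apply/gen_divisorsP/imsetP.
  move=> [c e]; exists (finv (lamX m) x); last by rewrite f_finv //; apply: lamX_inj.
  apply/gen_divisorsP; exists (g c); apply: (@lamA_inj m).
  by rewrite lamAM lamA_gen Kg f_finv //; apply: lamX_inj.
move=> [y /gen_divisorsP[c ->] ->]; exists (lamA m c).
by rewrite lamAM lamA_gen.
Qed.

(** A combinatorial form of the condition that [aY Y] has divisors in [Y] only; the two are linked
    by [gen_divisors_aY_sub] and [sig_closed_aYX]. *)
Definition sig_closed Y := forall x z, x \in Y -> z \in Y -> sig z x \in Y.

(** The injection [sig z] maps the finite set [Y] into itself, hence onto itself, so no element from
    outside can enter. *)
Lemma sig_closedE Y x z : sig_closed Y -> z \in Y -> (sig z x \in Y) = (x \in Y).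
Proof.
move=> cY zY; have sub : sig z @: Y \subset Y.
  by apply/subsetP => _ /imsetP[y yY ->]; apply: cY.
have /eqP E : sig z @: Y == Y.
  by rewrite eqEcard sub card_imset ?leqnn //; apply: sig_inj.
by rewrite -[X in _ \in pred_of_set X]E mem_imset //; apply: sig_inj.
Qed.

(** The letter [z] occurs on both sides of a defining relation; if it lies in [Y], then
    [sig_closedE] compares the other two letters. *)
Lemma sig_closed_cong Y u v : sig_closed Y -> pres_cong (derived_rel s) u v ->
  all [in Y] u = all [in Y] v.
Proof.
move=> cY; elim=> {u v} [u v /derived_relE[x [z [-> ->]]]|//|//|u v w _ -> //|].
  by rewrite /= !andbT andbC; case: (boolP (z \in Y)) => // zY; rewrite sig_closedE.
by move=> u v u' v' _ e1 _ e2; rewrite !all_cat e1 e2.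
Qed.

Lemma sig_closed_divisors Y w : sig_closed Y -> all [in Y] w ->
  gen_divisors (word_class (derived_rel s) w) \subset Y.
Proof.
move=> cY wY; apply/subsetP=> x /gen_divisorsP[c e].
have /word_classP/(sig_closed_cong cY) : word_class (derived_rel s) w =
    word_class (derived_rel s) (x :: repr c).
  by rewrite word_class_cons word_class_repr.
by rewrite wY => /esym /andP[].
Qed.

Lemma all_repr Y a : gen_divisors a \subset Y -> all [in Y] (repr a).
Proof. by move=> /subsetP aY; apply/allP => x /repr_gen_divisors/aY. Qed.

Lemma gen_divisors_mul_sub Y a b : sig_closed Y -> gen_divisors a \subset Y ->
  gen_divisors b \subset Y -> gen_divisors (a * b) \subset Y.
Proof.
move=> cY /all_repr aY /all_repr bY.
rewrite -[a]word_class_repr -[b]word_class_repr -word_class_cat.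
by apply: sig_closed_divisors => //; rewrite all_cat aY.
Qed.

Lemma gen_divisors_one Y : sig_closed Y -> gen_divisors (1 : A) \subset Y.
Proof. by move=> cY; apply: (@sig_closed_divisors Y [::]). Qed.

Lemma gen_submonoidP Y a : sig_closed Y ->
  gen_submonoid s Y a <-> gen_divisors a \subset Y.
Proof.
move=> cY; split.
  move=> aY; apply: (aY (fun b => is_true (gen_divisors b \subset Y))).
  split; last first.
    move=> _ [y yY ->]; rewrite -[Agen s y]/(word_class _ [:: y]).
    by apply: sig_closed_divisors; rewrite //= yY.
  split; first exact: gen_divisors_one.
  by move=> b c; apply: gen_divisors_mul_sub.
move=> /all_repr; rewrite -{2}[a]word_class_repr => aY T [[T1 TM] genT].
elim: (repr a) aY => [|x w IH] /=; first by rewrite word_class_nil.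
move=> /andP[xY wY]; rewrite word_class_cons.
by apply: TM (IH wY); apply: genT; exists x.
Qed.

Lemma sig_closedI Y Z : sig_closed Y -> sig_closed Z -> sig_closed (Y :&: Z).
Proof.
move=> cY cZ x z /setIP[xY xZ] /setIP[zY zZ].
by rewrite inE cY // cZ.
Qed.

End Derived.

(** * The central elements a_Y *)

Section Exponent.
Import fintype mathcomp.boot.finset.
Context {X : finType} (s : ybe_solution X) (d : nat).
Hypothesis hd : admissible_exponent s d.
Notation A := (derived_monoid s).
Notation M := (structure_monoid s).
Notation aY := (aY s d).
Notation mY := (mY s d).
Notation D m := (gen_divisors (cocycle m)).
Implicit Types (x y z : X) (w : seq X) (Y Z R : {set X}).
Implicit Types (a b c : A) (m h p : M).

Let d_ge2 : (2 <= d)%N. Proof. by case: hd. Qed.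

Lemma central_exp a : central (a ^+ d). Proof. by case: hd. Qed.

Lemma lamA_id m a : lamX m =1 id -> lamA m a = a.
Proof.
move=> m1; rewrite -[a]word_class_repr lamA_word (eq_map m1).
by rewrite map_id.
Qed.

Lemma lamX_exp a : lamX_of (a ^+ d) =1 id.
Proof.
case: hd => _ _ lam1 _ x; apply: (@Agen_inj _ s).
by rewrite -(lamA_gen (cocycle_inv (a ^+ d))) [LHS]lam1.
Qed.

(** The cocycle identity has no twist when [lamX_of a] is trivial, so [cocycle_inv] is
    multiplicative on [a * b]. *)
Lemma lamX_of_mul a b : lamX_of a =1 id -> lamX_of (a * b) =1 lamX_of b.
Proof.
move=> a1 x; rewrite /lamX_of.
have -> : cocycle_inv (a * b) = cocycle_inv a * cocycle_inv b.
  by apply: (can_inj (@cocycleK _ s)); rewrite cocycle_mul lamA_id ?cocycle_invK.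
by rewrite lamX_mul; apply: a1.
Qed.

Lemma aYE Y : aY Y = \prod_(y <- enum Y) Agen s y ^+ d.
Proof.
rewrite [LHS]/Defs.aY -big_filter.
apply: perm_prod_central => [i|]; first exact: central_exp.
by apply: uniq_perm; rewrite ?enum_uniq ?filter_uniq ?index_enum_uniq.
Qed.

Lemma aY_central Y : central (aY Y).
Proof. by rewrite aYE; apply: prod_central => i; apply: central_exp. Qed.

Lemma aYX_central Y j : central (aY Y ^+ j).
Proof. by move=> c; apply/esym/commuteX/esym/aY_central. Qed.

Lemma lamX_aY Y : lamX_of (aY Y) =1 id.
Proof.
rewrite aYE; elim: (enum Y) => [|y w IH] x.
  by rewrite big_nil -(expg1n _ d) lamX_exp.
by rewrite big_cons lamX_of_mul ?IH //; apply: lamX_exp.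
Qed.

Lemma lamA_exp h a j : lamA h (a ^+ j) = lamA h a ^+ j.
Proof. by elim: j => [|j IH]; rewrite ?expg0 ?lamA1 // !expgS lamAM IH. Qed.

Lemma lamA_aY h Y : lamA h (aY Y) = aY (lamX h @: Y).
Proof.
have -> : aY (lamX h @: Y) = \prod_(y <- map (lamX h) (enum Y)) Agen s y ^+ d.
  rewrite aYE; apply: perm_prod_central => [i|]; first exact: central_exp.
  apply: uniq_perm; rewrite ?enum_uniq // ?map_inj_uniq ?enum_uniq //.
    exact: lamX_inj.
  move=> x; rewrite mem_enum; apply/imsetP/mapP => -[y yY ->]; exists y => //.
    by rewrite mem_enum.
  by rewrite mem_enum in yY.
rewrite aYE; elim: (enum Y) => [|y w IH]; first by rewrite !big_nil lamA1.
by rewrite !big_cons lamAM IH lamA_exp lamA_gen.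
Qed.

Lemma cocycle_mY Y : cocycle (mY Y) = aY Y. Proof. exact: cocycle_invK. Qed.

Lemma lamX_mYX Y j : lamX (mY Y ^+ j) =1 id.
Proof.
elim: j => [|j IH] x; first by rewrite expg0 lamX_one.
by rewrite expgS lamX_mul /= IH; apply: lamX_aY.
Qed.

Lemma cocycle_inj : injective (@cocycle X s).
Proof. exact: can_inj (@cocycleK _ s). Qed.

Lemma cocycle1 : cocycle 1 = 1 :> A.
Proof. exact: cocycle_word_class. Qed.

Lemma cocycle_mYXM Y j m : cocycle (mY Y ^+ j * m) = aY Y ^+ j * cocycle m.
Proof.
elim: j m => [|j IH] m; first by rewrite !expg0 !mul1g.
rewrite !expgS -!mulgA cocycle_mul cocycle_mY lamA_id ?IH //.
exact: (lamX_mYX Y 1).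
Qed.

Lemma cocycle_mYX Y j : cocycle (mY Y ^+ j) = aY Y ^+ j.
Proof. by rewrite -[mY Y ^+ j]mulg1 cocycle_mYXM cocycle1 mulg1. Qed.

(** Although [aY Y] is central in A, the twist by [lamA h] turns it into [aY R]; powers of [mY]
    therefore pass through [h] with a change of index set. *)
Lemma mYX_swap h Y R j : lamX h @: Y = R -> h * mY Y ^+ j = mY R ^+ j * h.
Proof.
move=> hY; apply: cocycle_inj; rewrite cocycle_mYXM cocycle_mul cocycle_mYX.
by rewrite lamA_exp lamA_aY hY aYX_central.
Qed.

Lemma word_classX w j : word_class (derived_rel s) (flatten (nseq j w)) =
  (word_class (derived_rel s) w : A) ^+ j.
Proof.
elim: j => [|j IH]; first by rewrite expg0 -word_class_nil.
by rewrite /= word_class_cat IH expgS.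
Qed.

(** The length is recorded because each step of a stable sequence will supply one letter. *)
Lemma aY_word Y : exists w,
  [/\ aY Y = word_class (derived_rel s) w, all [in Y] w & size w = (#|Y| * d)%N].
Proof.
exists (flatten [seq nseq d y | y <- enum Y]); split.
- rewrite aYE; elim: (enum Y) => [|y w IH]; first by rewrite big_nil -word_class_nil.
  rewrite big_cons /= word_class_cat IH; congr (_ * _).
  rewrite [LHS](_ : _ = (word_class _ [:: y] : A) ^+ d) // -word_classX.
  by congr word_class; elim: d => //= n ->.
- apply/allP=> x /flattenP[_ /mapP[y yY ->]] /nseqP[-> _].
  by rewrite mem_enum in yY.
rewrite size_flatten /shape -map_comp (eq_map (g := fun=> d)) => [|y /=].
  by rewrite cardE; elim: (enum Y) => //= y w ->; rewrite mulSn.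
by rewrite size_nseq.
Qed.

Lemma aYX_word Y j : exists w,
  [/\ aY Y ^+ j = word_class (derived_rel s) w, all [in Y] w
    & size w = (j * (#|Y| * d))%N].
Proof.
have [w [-> wY <-]] := aY_word Y; exists (flatten (nseq j w)).
rewrite word_classX; split=> //.
  by elim: j => //= j IH; rewrite all_cat wY.
by elim: j => //= j IH; rewrite size_cat IH mulSn.
Qed.

Lemma aY_rem Y x : x \in Y -> exists r : A, [/\ aY Y = Agen s x ^+ d * r, central r
  & Y :\ x \subset gen_divisors r].
Proof.
move=> xY; exists (\prod_(y <- rem x (enum Y)) Agen s y ^+ d); split.
- have xY' : perm_eq (enum Y) (x :: rem x (enum Y)).
    by apply: perm_to_rem; rewrite mem_enum.
  rewrite aYE (perm_prod_central _ xY') ?big_cons // => i; exact: central_exp.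
- by apply: prod_central => i; apply: central_exp.
apply/subsetP=> z; rewrite 2!inE => /andP[zx zY].
have: z \in rem x (enum Y) by rewrite mem_rem_uniq ?enum_uniq // inE zx mem_enum.
elim: (rem _ _) => // y r IH; rewrite inE big_cons => /predU1P[<-|/IH zr].
  apply: (subsetP (gen_divisors_mull _ _)); apply/gen_divisorsP.
  by rewrite -(prednK (ltnW d_ge2)) expgS; exists (Agen s z ^+ d.-1).
exact: (subsetP (gen_divisors_mulr _ _)).
Qed.

Lemma sub_gen_divisors_aY Y : Y \subset gen_divisors (aY Y).
Proof.
apply/subsetP=> x /aY_rem[r [-> _ _]]; apply/gen_divisorsP.
by rewrite -(prednK (ltnW d_ge2)) expgS -mulgA; exists (Agen s x ^+ d.-1 * r).
Qed.

(* Two letters x, z of Y can be made adjacent in a word for a_Y, even if x = z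
   because d >= 2, so rewriting x + z = z + sig z x shows that sig z x divides
   a_Y. *)
Lemma gen_divisors_aY_sub Y : gen_divisors (aY Y) \subset Y -> sig_closed s Y.
Proof.
move=> /subsetP nY x z xY zY; apply: nY.
have : divides (Agen s x * Agen s z) (aY Y).
  have [r [-> _ rY]] := aY_rem xY; have [->|zx] := eqVneq z x.
    apply: divides_mulr; move: d_ge2; case: d => // -[//|n] _.
    by exists (Agen s x ^+ n); rewrite !expgS mulgA.
  apply: divides_mul.
    by rewrite -(prednK (ltnW d_ge2)) expgS; exists (Agen s x ^+ d.-1).
  by apply/gen_divisorsP; apply: (subsetP rY); rewrite !inE zx.
rewrite Agen_sig => H; apply/gen_divisorsP; apply: divides_trans H.
by apply: divides_mull; exists 1; rewrite mulg1.
Qed.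

Lemma sig_closed_aYX Y j : sig_closed s Y -> gen_divisors (aY Y ^+ j) \subset Y.
Proof.
move=> cY; have [w [-> wY _]] := aYX_word Y j; exact: sig_closed_divisors.
Qed.

(** A letter [x] of [Y] is completed to [aY Y] by [Agen s x ^+ d.-1] and the remaining central
    factor. As [aY Y] is central, the complements of the letters of a word can be nested. *)
Lemma aY_complement Y a : gen_divisors a \subset Y ->
  exists (a' : A) j, a * a' = aY Y ^+ j /\ a' * a = aY Y ^+ j.
Proof.
move=> /all_repr aY; rewrite -(word_class_repr a).
elim: (repr a) aY => [_|x w IH /= /andP[xY /IH[b' [j [e1 e2]]]]].
  by exists 1, 0; rewrite word_class_nil !mulg1.
have [r [e cr _]] := aY_rem xY; rewrite word_class_cons.
set g := Agen s x in e *; set c := g ^+ d.-1 * r; exists (b' * c), j.+1.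
have dE : d.-1.+1 = d by lia.
have gc : g * c = aY Y by rewrite /c mulgA -expgS dE.
have cg : c * g = aY Y by rewrite /c -mulgA cr mulgA -expgSr dE.
split; rewrite expgSr -mulgA.
  by rewrite [_ * (b' * _)]mulgA e1 mulgA -aYX_central -mulgA gc.
by rewrite [c * _]mulgA cg aY_central mulgA e2.
Qed.

(** * Divisors and local inverses in M *)

Lemma divisors_mull m p : D m \subset D (m * p).
Proof. by rewrite cocycle_mul; apply: gen_divisors_mull. Qed.

Lemma divisors_mulr m p : lamX m @: D p \subset D (m * p).
Proof. by rewrite cocycle_mul -gen_divisors_lamA; apply: gen_divisors_mulr. Qed.

Lemma divisors_mul_sub Y m p : sig_closed s Y ->
  D m \subset Y -> lamX m @: D p \subset Y -> D (m * p) \subset Y.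
Proof.
move=> cY mY pY; rewrite cocycle_mul; apply: gen_divisors_mul_sub => //.
by rewrite gen_divisors_lamA.
Qed.

Lemma divisors_mYX Y j : sig_closed s Y -> D (mY Y ^+ j) \subset Y.
Proof. by move=> cY; rewrite cocycle_mYX; apply: sig_closed_aYX. Qed.

Lemma sub_divisors_mYXM Y j m : Y \subset D (mY Y ^+ j.+1 * m).
Proof.
rewrite cocycle_mYXM expgS -mulgA.
exact: subset_trans (sub_gen_divisors_aY Y) (gen_divisors_mull _ _).
Qed.

Lemma lamX_mul_imset m p Y : lamX (m * p) @: Y = lamX m @: (lamX p @: Y).
Proof. by rewrite -imset_comp; apply/eq_imset/lamX_mul. Qed.

Lemma lamX_id_imset m Y : lamX m =1 id -> lamX m @: Y = Y.
Proof. by move=> m1; rewrite (eq_imset _ m1) imset_id. Qed.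

Lemma lamX_mYXM_imset Y R j m : lamX (mY Y ^+ j * m) @: R = lamX m @: R.
Proof. by rewrite lamX_mul_imset lamX_id_imset //; apply: lamX_mYX. Qed.

(** Both sides are divisor conditions on some [aY], and [lamA h] transports one to the other. *)
Lemma sig_closed_lamX h Y : sig_closed s (lamX h @: Y) <-> sig_closed s Y.
Proof.
have aYE1 R : sig_closed s R <-> gen_divisors (aY R) \subset R.
  split; last exact: gen_divisors_aY_sub.
  by move=> /(@sig_closed_aYX _ 1); rewrite expg1.
rewrite !aYE1 -lamA_aY gen_divisors_lamA; split; last exact: imsetS.
move=> /subsetP sub; apply/subsetP=> x /(imset_f (lamX h))/sub.
by rewrite mem_imset //; apply: lamX_inj.
Qed.

(** The complement [a'] of [cocycle h] has to be untwisted by the inverse of [lamA h]. The second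
    product is checked after applying the injective [lamA h]. *)
Lemma local_inverse h Y R : sig_closed s R -> D h \subset R -> lamX h @: Y = R ->
  exists (h' : M) j, h * h' = mY R ^+ j /\ h' * h = mY Y ^+ j.
Proof.
move=> cR hR hY; have [a' [j [e1 e2]]] := aY_complement hR.
have [g gK Kg] := lamA_bij h.
exists (cocycle_inv (g a')), j.
have E : h * cocycle_inv (g a') = mY R ^+ j.
  by apply: cocycle_inj; rewrite cocycle_mul cocycle_invK Kg e1 cocycle_mYX.
split=> //; apply: cocycle_inj; apply: (@lamA_inj _ s h).
rewrite cocycle_mul cocycle_invK lamAM Kg -lamA_mul E cocycle_mYX.
by rewrite lamA_id ?e2 ?lamA_exp ?lamA_aY ?hY //; apply: lamX_mYX.
Qed.

Lemma lamX_local_inverse h h' Y R j :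
  h * h' = mY R ^+ j -> h' * h = mY Y ^+ j ->
  cancel (lamX h) (lamX h') /\ cancel (lamX h') (lamX h).
Proof.
move=> e1 e2; split=> x.
  by rewrite -[LHS](lamX_mul h' h) e2 lamX_mYX.
by rewrite -[LHS](lamX_mul h h') e1 lamX_mYX.
Qed.

Lemma cancel_imset (f g : X -> X) Y : cancel f g -> g @: (f @: Y) = Y.
Proof. by move=> fK; rewrite -imset_comp (eq_imset _ fK) imset_id. Qed.

Lemma local_inverse_lamX h Y R :
  sig_closed s R -> D h \subset R -> lamX h @: Y = R ->
  exists h' : M, [/\ D h' \subset Y, cancel (lamX h) (lamX h')
    & cancel (lamX h') (lamX h)].
Proof.
move=> cR hR hY; have [h' [j [e1 e2]]] := local_inverse cR hR hY; exists h'.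
have [K1 K2] := lamX_local_inverse e1 e2; split=> //.
apply: subset_trans (divisors_mull h' h) _; rewrite e2; apply: divisors_mYX.
by apply/(sig_closed_lamX h); rewrite hY.
Qed.

(** * Malcev nilpotency excludes (NC) *)

(** [P] and [Q] are the right supports of [x] and [y]. The new term ends in [y], so it inherits the
    right support [Q]. *)
Lemma malcev_step (x u y : M) Y Z (P Q : {set X}) : sig_closed s Y ->
  D x = Y -> D y = Z -> lamX x @: P = Y -> lamX y @: Q = Z ->
  lamX u @: Z = P -> D u \subset P ->
  D (x * u * y) = Y /\ lamX (x * u * y) @: Q = Y.
Proof.
move=> cY Dx Dy xP yQ uZ uP; rewrite !lamX_mul_imset yQ uZ; split=> //.
apply/eqP; rewrite eqEsubset -{2}Dx -mulgA divisors_mull andbT mulgA.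
apply: divisors_mul_sub; rewrite ?lamX_mul_imset ?Dy ?uZ ?xP //.
by apply: divisors_mul_sub; rewrite ?Dx // -xP imsetS.
Qed.

Lemma malcev_nilpotent_not_NC :
  malcev_nilpotent [set: M]%classic -> ~ nilpotency_condition s d.
Proof.
move=> [k kP] [Y [Z [YZ nY nZ [a [b [aT bT abY abZ]]]]]].
have cY : sig_closed s Y.
  by apply: gen_divisors_aY_sub; apply/subsetP=> x /gen_divisorsP/nY.
have cZ : sig_closed s Z.
  by apply: gen_divisors_aY_sub; apply/subsetP=> x /gen_divisorsP/nZ.
have cT := sig_closedI cY cZ.
move: aT bT => /gen_submonoidP-/(_ cT) aT /gen_submonoidP-/(_ cT) bT.
set h := cocycle_inv a; set g := cocycle_inv b.
have hT : D h \subset Y :&: Z by rewrite cocycle_invK.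
have gT : D g \subset Y :&: Z by rewrite cocycle_invK.
set R := lamX_of a @^-1: Y in abY; set R' := lamX_of a @^-1: Z in abZ.
have pre (S : {set X}) : lamX h @: (lamX h @^-1: S) = S.
  apply/setP=> x; apply/imsetP/idP => [[y] /[!inE] yS -> //|xS].
  exists (finv (lamX h) x); first by rewrite inE f_finv //; apply: lamX_inj.
  by rewrite f_finv //; apply: lamX_inj.
have hR : lamX h @: R = Y := pre Y.
have hR' : lamX h @: R' = Z := pre Z.
have hRR' : lamX h @: (R :&: R') = Y :&: Z.
  by rewrite imsetI; [rewrite hR hR' | apply: in2W; apply: lamX_inj].
have gRR' : lamX g @: (R :&: R') = Y :&: Z.
  by rewrite imsetI; [rewrite abY abZ setIC | apply: in2W; apply: lamX_inj].
(* Both [h] and [g] carry [R :&: R'] onto [Y :&: Z], so the divisors of their local inverses lie in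
   [R] and in [R'], as [malcev_step] requires for both sequences. *)
have [h' [Dh' hK _]] := local_inverse_lamX cT hT hRR'.
have [g' [Dg' gK _]] := local_inverse_lamX cT gT gRR'.
move: Dh' Dg'; rewrite !subsetI => /andP[Dh'R Dh'R'] /andP[Dg'R Dg'R'].
(* The right supports of the two terms are [R] and [R'] at even steps and are exchanged at odd ones.
   Accordingly [g'] sends [Y], [Z] to [R'], [R], while [h'] sends them to [R], [R']. *)
pose u i := if odd i then h' else g'.
have inv i : let: (x, y) := malcev_seq (mY Y * h) (mY Z * h) u i in
    [/\ D x = Y, D y = Z, lamX x @: (if odd i then R' else R) = Y
      & lamX y @: (if odd i then R else R') = Z].
  elim: i => [|i] /=.
    have start (S : {set X}) :
        sig_closed s S -> Y :&: Z \subset S -> D (mY S * h) = S.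
      move=> cS TS; rewrite -[mY S]expg1; apply/eqP.
      rewrite eqEsubset sub_divisors_mYXM andbT divisors_mul_sub //.
        exact: divisors_mYX.
      by rewrite lamX_id_imset ?(subset_trans hT) //; apply: lamX_mYX.
    split; rewrite ?start ?subsetIl ?subsetIr // lamX_mul_imset ?hR ?hR'.
      exact/lamX_id_imset/lamX_aY.
    exact/lamX_id_imset/lamX_aY.
  case: malcev_seq => x y [Dx Dy]; rewrite /u; case: (odd i) => /= xP yP.
    have h'Z : lamX h' @: Z = R' by rewrite -hR' cancel_imset.
    have h'Y : lamX h' @: Y = R by rewrite -hR cancel_imset.
    have [? ?] := malcev_step cY Dx Dy xP yP h'Z Dh'R'.
    by have [? ?] := malcev_step cZ Dy Dx yP xP h'Y Dh'R.
  have g'Z : lamX g' @: Z = R by rewrite -abY cancel_imset.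
  have g'Y : lamX g' @: Y = R' by rewrite -abZ cancel_imset.
  have [? ?] := malcev_step cY Dx Dy xP yP g'Z Dg'R.
  by have [? ?] := malcev_step cZ Dy Dx yP xP g'Y Dg'R'.
have uT i : (i < k)%N -> [set: M]%classic (u i) \/ u i = 1 by left.
have := kP (mY Y * h) (mY Z * h) u I I uT; have := inv k.
by case: malcev_seq => x y [Dx Dy _ _] /= exy; apply: YZ; rewrite -Dx -Dy exy.
Qed.

(** * Sequences with constant divisors *)

Lemma malcev_seqS (p q : M) u k : malcev_seq p q u k.+1 =
  ((malcev_seq p q u k).1 * u k * (malcev_seq p q u k).2,
   (malcev_seq p q u k).2 * u k * (malcev_seq p q u k).1).
Proof. by rewrite /=; case: malcev_seq. Qed.

Lemma malcev_seq_swap (p q : M) u k : malcev_seq q p u k =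
  ((malcev_seq p q u k).2, (malcev_seq p q u k).1).
Proof. by elim: k => // k IH; rewrite !malcev_seqS IH. Qed.

Definition stable (p q : M) u K Y Z := forall k, (k <= K)%N ->
  D (malcev_seq p q u k).1 = Y /\ D (malcev_seq p q u k).2 = Z.

Lemma stable_swap p q u K Y Z : stable p q u K Y Z -> stable q p u K Z Y.
Proof. by move=> st k /st[]; rewrite (malcev_seq_swap p q). Qed.

Lemma imset_lamX_sub m Y Z : (lamX m @: Y \subset lamX m @: Z) = (Y \subset Z).
Proof.
apply/idP/idP => [/subsetP sub|]; last exact: imsetS.
apply/subsetP=> x /(imset_f (lamX m))/sub.
by rewrite mem_imset //; apply: lamX_inj.
Qed.

Section Stable.
Context (p q : M) (u : nat -> M) (K : nat) (Y Z : {set X}).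
Hypothesis st : stable p q u K Y Z.
Hypothesis YZ : #|Y| = #|Z|.
Notation x k := (malcev_seq p q u k).1.
Notation y k := (malcev_seq p q u k).2.

(** The left side is contained in the divisor set [Y] of the next term and has the same
    cardinality. *)
Lemma stable_lamX k : (k < K)%N -> lamX (x k) @: (lamX (u k) @: Z) = Y.
Proof.
move=> kK; have [Dx Dy] := st (ltnW kK); have [] := st kK.
rewrite malcev_seqS /= => DY _; rewrite -lamX_mul_imset.
have := divisors_mulr (x k * u k) (y k); rewrite DY Dy => sub.
apply/eqP; rewrite eqEcard sub card_imset ?YZ ?leqnn //; exact: lamX_inj.
Qed.

Lemma stable_divisors k : (k < K)%N -> D (u k) \subset lamX (u k) @: Z.
Proof.
move=> kK; have [] := st kK; rewrite malcev_seqS /= => DY _.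
rewrite -(imset_lamX_sub (x k)) stable_lamX // -DY.
exact: subset_trans (divisors_mulr _ _) (divisors_mull _ _).
Qed.

(* Each step appends a factor divisible by every letter of Y. *)
Lemma stable_divides w k : all [in Y] w -> (size w <= k <= K)%N ->
  divides (word_class (derived_rel s) w) (cocycle (x k)).
Proof.
elim/last_ind: w k => [|w z IH] k.
  by exists (cocycle (x k)); rewrite word_class_nil mul1g.
rewrite all_rcons size_rcons => /andP[zY wY]; case: k => // k /andP[wk kK].
rewrite malcev_seqS -mulgA cocycle_mul -cats1 word_class_cat.
apply: divides_mul; first by apply: IH; rewrite // -ltnS wk ltnW.
apply/gen_divisorsP; rewrite cocycle_mul lamAM -lamA_mul -/(Agen s z).
apply: (subsetP (gen_divisors_mulr _ _)).
have [_ Dy] := st (ltnW kK).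
by rewrite gen_divisors_lamA Dy lamX_mul_imset stable_lamX.
Qed.

Lemma stable_divides_aY j : (j * (#|Y| * d) <= K)%N ->
  divides (aY Y ^+ j) (cocycle (x K)).
Proof.
have [w [-> wY <-]] := aYX_word Y j => wK.
by apply: stable_divides; rewrite // wK leqnn.
Qed.

Lemma stable_sig_closed : (#|Y| * d <= K)%N -> sig_closed s Y.
Proof.
move=> YK; apply: gen_divisors_aY_sub.
have [Dx _] := st (leqnn K); rewrite -{2}Dx.
have [c ->] := @stable_divides_aY 1 (leq_trans (eq_leq (mul1n _)) YK).
by rewrite expg1; apply: gen_divisors_mull.
Qed.

End Stable.

(** The witnesses for (NC) come from the local inverses of [u 0] and [u 1] over [R :&: R']; having
    [2 <= K] makes both parameters available. *)
Lemma stable_eq p q u K Y Z : ~ nilpotency_condition s d ->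
  stable p q u K Y Z -> #|Y| = #|Z| -> (#|Y| * d <= K)%N -> (2 <= K)%N -> Y = Z.
Proof.
move=> nNC st YZ YK K2; apply: contra_notP nNC => neqYZ.
have st' := stable_swap st; have ZY := esym YZ.
have ZK : (#|Z| * d <= K)%N by rewrite ZY.
have cY := stable_sig_closed st YZ YK.
have cZ := stable_sig_closed st' ZY ZK.
set R := lamX (u 0%N) @: Z; set R' := lamX (u 0%N) @: Y.
have DR : D (u 0%N) \subset R := stable_divisors st YZ (ltnW K2).
have DR' : D (u 0%N) \subset R' := stable_divisors st' ZY (ltnW K2).
have xR : lamX p @: R = Y := stable_lamX st YZ (ltnW K2).
have yR' : lamX q @: R' = Z := stable_lamX st' ZY (ltnW K2).
(* The second term [p * u 0 * q] carries both sets onto [Y]. *)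
have u1Z : lamX (u 1%N) @: Z = R'.
  apply: (imset_inj (@lamX_inj _ _ (p * u 0%N * q))).
  by rewrite (stable_lamX st YZ K2) !lamX_mul_imset yR' -xR.
have u1Y : lamX (u 1%N) @: Y = R.
  apply: (imset_inj (@lamX_inj _ _ (q * u 0%N * p))).
  by rewrite (stable_lamX st' ZY K2) !lamX_mul_imset xR -yR'.
have cRR' : sig_closed s (R :&: R').
  by apply: sig_closedI; apply/sig_closed_lamX.
have imI v : lamX v @: (Y :&: Z) = lamX v @: Y :&: lamX v @: Z.
  by rewrite imsetI //; apply: in2W; apply: lamX_inj.
have u0I : lamX (u 0%N) @: (Y :&: Z) = R :&: R' by rewrite imI setIC.
have u1I : lamX (u 1%N) @: (Y :&: Z) = R :&: R' by rewrite imI u1Z u1Y.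
have D0 : D (u 0%N) \subset R :&: R' by rewrite subsetI DR.
have D1 : D (u 1%N) \subset R :&: R'.
  rewrite subsetI -{1}u1Y -u1Z.
  by rewrite (stable_divisors st YZ K2) (stable_divisors st' ZY K2).
have [a [aT aK Ka]] := local_inverse_lamX cRR' D0 u0I.
have [b [bT bK Kb]] := local_inverse_lamX cRR' D1 u1I.
have pre (S : {set X}) : lamX a @^-1: S = lamX (u 0%N) @: S.
  apply/setP=> z; rewrite inE; apply/idP/imsetP => [zS|[z' z'S ->]].
    by exists (lamX a z).
  by rewrite aK.
exists Y, Z; split=> //.
- move=> z /gen_divisorsP zY; apply: (subsetP (sig_closed_aYX 1 cY)).
  by rewrite expg1.
- move=> z /gen_divisorsP zZ; apply: (subsetP (sig_closed_aYX 1 cZ)).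
  by rewrite expg1.
exists (cocycle a), (cocycle b); split.
- by apply/gen_submonoidP => //; apply: sig_closedI.
- by apply/gen_submonoidP => //; apply: sig_closedI.
- by rewrite /lamX_of !cocycleK pre -/R' -u1Z cancel_imset.
by rewrite /lamX_of !cocycleK pre -/R -u1Y cancel_imset.
Qed.

Lemma MYY_intro Y m : D m = Y -> lamX m @: Y = Y -> MYY s Y m.
Proof.
move=> Dm mY; split; first by rewrite /A_ge Dm /= ltnn.
  by move=> y yY; apply/gen_divisorsP; rewrite Dm.
by rewrite /lamX_of cocycleK.
Qed.

Lemma not_A_ge_aY Y : sig_closed s Y -> ~ A_ge s #|Y|.+1 (aY Y).
Proof.
move=> /(sig_closed_aYX 1); rewrite expg1 => /subset_leq_card.
by rewrite /A_ge leqNgt => /negP.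
Qed.

(** * Stable sequences with equal divisor sets *)

Section StableEqual.
Context (Y R : {set X}) (h h' p q : M) (u : nat -> M) (J K : nat).
Hypothesis cY : sig_closed s Y.
Hypothesis Dh : D h \subset R.
Hypothesis hY : lamX h @: Y = R.
Hypothesis hh' : h * h' = mY R ^+ J.
Hypothesis h'h : h' * h = mY Y ^+ J.
Hypothesis st : stable p q u K Y Y.
Notation x k := (malcev_seq p q u k).1.
Notation y k := (malcev_seq p q u k).2.
Hypothesis uR : forall k, (k < K)%N -> lamX (u k) @: Y = R.
Hypothesis xR : forall k, (k <= K)%N -> lamX (x k) @: R = Y.
Hypothesis yR : forall k, (k <= K)%N -> lamX (y k) @: R = Y.
Hypothesis canc : cancellative (mY_MYY s d Y).
Hypothesis nil : forall p q u, mY_MYY s d Y p -> mY_MYY s d Y q ->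
  (forall i, (i < K)%N -> mY_MYY s d Y (u i) \/ u i = 1) ->
  (malcev_seq p q u K).1 = (malcev_seq p q u K).2.
Hypothesis JK : (J.+2 * (#|Y| * d) <= K)%N.

(** One factor [mY Y] makes every letter of [Y] a divisor, which gives membership in [MYY]; the
    other is the outer factor of [mY_MYY]. *)
Let mY_MYY_intro m : D m \subset Y -> lamX m @: Y = Y ->
  mY_MYY s d Y (mY Y * (mY Y * m)).
Proof.
move=> Dm mY; exists (Defs.mY s d Y * m) => //; apply: MYY_intro.
  apply/eqP; rewrite eqEsubset (@sub_divisors_mYXM Y 0 m) andbT.
  apply: divisors_mul_sub => //; first exact: (divisors_mYX 1).
  by rewrite lamX_id_imset //; apply: (lamX_mYX Y 1).
by rewrite lamX_mul_imset mY; apply/lamX_id_imset/(lamX_mYX Y 1).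
Qed.

Let mulh m : D m = Y -> lamX m @: R = Y ->
  D (m * h) = Y /\ lamX (m * h) @: Y = Y.
Proof.
move=> Dm mR; rewrite lamX_mul_imset hY; split=> //.
apply/eqP; rewrite eqEsubset -{2}Dm divisors_mull andbT.
by rewrite divisors_mul_sub // ?Dm // -mR imsetS.
Qed.

Let pull m n j : lamX m @: Y = Y -> m * (mY Y ^+ j * n) = mY Y ^+ j * (m * n).
Proof. by move=> mY; rewrite mulgA (mYX_swap j mY) mulgA. Qed.

(** The inner product [h * h'] is [mY R ^+ J], which moves left through [m] as [mY Y ^+ J]. *)
Let pull_mul m g n : lamX m @: R = Y ->
  m * h * (h' * g) * (n * h) = mY Y ^+ J * (m * g * n * h).
Proof.
move=> mR; rewrite -!mulgA [h * (h' * _)]mulgA hh' [m * (_ * _)]mulgA.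
by rewrite (mYX_swap J mR) !mulgA.
Qed.

Let lamXh'g g : lamX g @: Y = R -> lamX (h' * g) @: Y = Y.
Proof.
move=> gY; rewrite lamX_mul_imset gY -hY -lamX_mul_imset h'h lamX_id_imset //.
exact: lamX_mYX.
Qed.

(** Both terms acquire the same exponent [e], which is what permits cancellation afterwards. *)
Let transport k : (k <= K)%N -> exists e,
  malcev_seq (mY Y * (p * h)) (mY Y * (q * h))
    (fun i => mY Y * (mY Y * (h' * u i))) k =
  (mY Y ^+ e * (x k * h), mY Y ^+ e * (y k * h)).
Proof.
elim: k => [_|k IH kK]; first by exists 1%N.
(* The new exponent collects [e] from each of the two terms, 2 from the parameter and [J] from
   [h * h']. *)
have [e E] := IH (ltnW kK); exists (e + 2 + e + J)%N.
have [Dx Dy] := st (ltnW kK).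
have [_ xh] := mulh Dx (xR (ltnW kK)); have [_ yh] := mulh Dy (yR (ltnW kK)).
have gY := lamXh'g (uR kK).
have calc m n : lamX m @: R = Y -> lamX (m * h) @: Y = Y ->
  mY Y ^+ e * (m * h) * (mY Y * (mY Y * (h' * u k))) * (mY Y ^+ e * (n * h)) =
  mY Y ^+ (e + 2 + e + J) * (m * u k * n * h).
  move=> mR mh; have mg : lamX (m * h * (h' * u k)) @: Y = Y.
    by rewrite lamX_mul_imset gY.
  rewrite [mY Y * (_ * (h' * _))]mulgA -expg2 -[_ * (m * h) * _]mulgA.
  rewrite (pull _ _ mh) [mY Y ^+ e * (_ * (m * h * _))]mulgA.
  rewrite -[_ * (m * h * _) * _]mulgA (pull _ _ mg) (pull_mul _ _ mR).
  by rewrite !expgnDr -!mulgA.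
rewrite malcev_seqS E !malcev_seqS /= !calc //.
  exact: yR (ltnW kK).
exact: xR (ltnW kK).
Qed.

Lemma stable_malcev_eq : x K = y K.
Proof.
have [Dp Dq] := st (leq0n K); have [DxK DyK] := st (leqnn K).
have MYYh m : D m = Y -> lamX m @: R = Y -> mY_MYY s d Y (mY Y * (m * h)).
  by move=> Dm mR; have [? ?] := mulh Dm mR; exists (m * h) => //; apply: MYY_intro.
have [e E] := transport (leqnn K).
have := nil (MYYh p Dp (xR (leq0n K))) (MYYh q Dq (yR (leq0n K))).
move=> /(_ (fun i => mY Y * (mY Y * (h' * u i)))); rewrite E /= => eqK.
have {}eqK : mY Y ^+ e * (x K * h) = mY Y ^+ e * (y K * h).
  apply: eqK => i iK; left; apply: mY_MYY_intro; last exact: lamXh'g (uR iK).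
  apply: divisors_mul_sub => //.
    apply: subset_trans (divisors_mull h' h) _.
    by rewrite h'h; apply: divisors_mYX.
  have -> : Y = lamX h' @: R.
    by rewrite -hY -lamX_mul_imset h'h lamX_id_imset //; apply: lamX_mYX.
  by rewrite imsetS // -(uR iK); apply: stable_divisors st _ _ iK.
(* The power [J] will be recovered from [h * h'] at the end; the other two factors put the quotient
   into [mY_MYY]. *)
have split_mY m : divides (aY Y ^+ J.+2) (cocycle m) ->
    exists n, m = mY Y ^+ J * (mY Y ^+ 2 * n).
  move=> [c mc]; exists (cocycle_inv c); apply: cocycle_inj.
  by rewrite mulgA -expgnDr cocycle_mYXM cocycle_invK mc addn2.
have [x' xE] := split_mY _ (stable_divides_aY st erefl JK).
have [y' yE] := split_mY _ (stable_divides_aY (stable_swap st) erefl JK).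
rewrite (malcev_seq_swap p q) /= in yE.
have key m n : m = mY Y ^+ J * (mY Y ^+ 2 * n) -> D m = Y -> lamX m @: R = Y ->
    lamX n @: R = Y /\ mY_MYY s d Y (mY Y ^+ 2 * n * h).
  move=> mE Dm mR; have nR : lamX n @: R = Y.
    by rewrite -mR mE 2!lamX_mYXM_imset.
  have [Dmh _] := mulh Dm mR.
  split=> //; rewrite expg2 -!mulgA; apply: mY_MYY_intro.
    rewrite -Dmh mE -mulgA cocycle_mYXM -[_ ^+ 2 * n * h]mulgA cocycle_mYXM.
    exact: subset_trans (gen_divisors_mulr _ _) (gen_divisors_mulr _ _).
  by rewrite lamX_mul_imset hY.
have [x'R Sx] := key _ _ xE DxK (xR (leqnn K)).
have [y'R Sy] := key _ _ yE DyK (yR (leqnn K)).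
(* The two extra factors ensure membership whatever [e] and [J] are; [shift] accounts for them by
   multiplying [eqK] by [mY Y ^+ 2]. *)
have S2 : mY_MYY s d Y (mY Y ^+ (e + J).+2).
  rewrite 2!expgS; apply: mY_MYY_intro; first exact: divisors_mYX.
  exact/lamX_id_imset/lamX_mYX.
have [/(_ _)] := canc S2 Sx Sy; move=> cancel _.
have shift n : mY Y ^+ (e + J).+2 * (mY Y ^+ 2 * n * h) =
    mY Y ^+ 2 * (mY Y ^+ e * (mY Y ^+ J * (mY Y ^+ 2 * n) * h)).
  by rewrite -addn2 addnC !expgnDr -!mulgA.
have {cancel}eq' : mY Y ^+ 2 * x' * h = mY Y ^+ 2 * y' * h.
  by apply: cancel; rewrite !shift -xE -yE eqK.
(* Right multiplication by [h'] trades [h] for the missing [mY Y ^+ J], so [h] is removed without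
   any cancellation in M. *)
have fin m n : lamX n @: R = Y -> mY Y ^+ J * (mY Y ^+ 2 * n) =
    mY Y ^+ 2 * n * h * h'.
  move=> nR; rewrite -[_ * h * h']mulgA hh' -[_ * n * _]mulgA (mYX_swap J nR).
  by rewrite [LHS]mulgA [RHS]mulgA -!expgnDr addnC.
by rewrite xE yE !fin // eq'.
Qed.

End StableEqual.

(** * Uniform bounds and the converse direction *)

Lemma uniform_local_inverse : exists J, forall Y R, sig_closed s R ->
  (exists h : M, D h \subset R /\ lamX h @: Y = R) -> exists h h' : M,
  [/\ D h \subset R, lamX h @: Y = R, h * h' = mY R ^+ J & h' * h = mY Y ^+ J].
Proof.
have [|[Y R]|J JP] := @finite_uniform_bound ({set X} * {set X})%type
  (fun YR J => sig_closed s YR.2 ->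
    (exists h : M, D h \subset YR.2 /\ lamX h @: YR.1 = YR.2) ->
    exists h h' : M, [/\ D h \subset YR.2, lamX h @: YR.1 = YR.2,
      h * h' = mY YR.2 ^+ J & h' * h = mY YR.1 ^+ J]).
- move=> [Y R] /= k l /subnKC <- H cR /(H cR)[h [h' [hR hY e1 e2]]].
  (* Raising the common exponent costs only a further power of [mY R], which becomes a power of
     [mY Y] when moved through [h]. *)
  exists h, (h' * mY R ^+ (l - k)); split=> //.
    by rewrite mulgA e1 expgnDr.
  by rewrite -mulgA -(mYX_swap _ hY) mulgA e2 expgnDr.
- case: (pselect (sig_closed s R /\
    exists h : M, D h \subset R /\ lamX h @: Y = R)).
    move=> [cR [h [hR hY]]]; have [h' [j [e1 e2]]] := local_inverse cR hR hY.
    by exists j => _ _; exists h, h'.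
  by move=> nR; exists 0%N => /= cR ex; case: nR.
by exists J => Y R; apply: (JP (Y, R)).
Qed.

Lemma stable_bound :
  (forall Y, Y != set0 -> ~ M_ge s #|Y|.+1 (mY Y) ->
    malcev_nilpotent (mY_MYY s d Y)) ->
  ~ nilpotency_condition s d ->
  exists K, forall p q u Y Z, stable p q u K Y Z -> #|Y| = #|Z| ->
    (malcev_seq p q u K).1 = (malcev_seq p q u K).2.
Proof.
move=> Hnil nNC.
(* The bound [c] serves every relevant [Y] and every length beyond it, since the final length [K] is
   fixed only later. *)
have [|Y|c cP] := @finite_uniform_bound {set X}
  (fun Y k => Y != set0 -> sig_closed s Y -> forall l, (k <= l)%N ->
    forall (p q : M) u, mY_MYY s d Y p -> mY_MYY s d Y q ->
    (forall i, (i < l)%N -> mY_MYY s d Y (u i) \/ u i = 1) ->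
    (malcev_seq p q u l).1 = (malcev_seq p q u l).2).
- by move=> Y k l kl H Y0 cY r lr; apply: H => //; apply: leq_trans lr.
- case: (pselect (Y != set0 /\ sig_closed s Y)) => [[Y0 cY]|nY]; last first.
    by exists 0%N => Y0 cY; case: nY.
  have [|k kP] := Hnil Y Y0.
    by rewrite /M_ge cocycle_mY; apply: not_A_ge_aY.
  exists k => _ _ l kl p q u Sp Sq uS; apply: (malcev_seq_eq kl).
  by apply: kP => // i ik; apply: uS; apply: leq_trans kl.
have [J JP] := uniform_local_inverse.
(* The 2 is for [stable_eq], [c] for nilpotency of the local semigroups, and the last term for
   divisibility by [aY Y ^+ J.+2], uniformly in [Y]. *)
exists (maxn 2 (maxn c (J.+2 * (#|X| * d)))); set K := maxn _ _.
have [K2 cK] : (2 <= K)%N /\ (c <= K)%N by rewrite !leq_max !leqnn !orbT.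
have JK (Y : {set X}) : (J.+2 * (#|Y| * d) <= K)%N.
  rewrite 2!leq_max; apply/orP; right; apply/orP; right.
  by rewrite leq_mul2l leq_mul2r max_card !orbT.
move=> p q u Y Z st YZ.
have YK : (#|Y| * d <= K)%N by apply: leq_trans (JK Y); rewrite leq_pmull.
have eqYZ := stable_eq nNC st YZ YK K2; subst Z.
(* The assumptions on local semigroups concern non-empty [Y]; for empty [Y] both terms are
   trivial. *)
have [Y0|Y0] := eqVneq Y set0.
  have [Dx Dy] := st K (leqnn K).
  apply: cocycle_inj; rewrite (gen_divisors0 (etrans Dx Y0)).
  by rewrite (gen_divisors0 (etrans Dy Y0)).
have cY := stable_sig_closed st YZ YK.
have stC := stable_swap st.
have uY k : (k < K)%N ->
    lamX (malcev_seq p q u k).1 @: (lamX (u k) @: Y) = Y /\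
    lamX (malcev_seq p q u k).2 @: (lamX (u k) @: Y) = Y.
  move=> kK; split; first exact: (stable_lamX st).
  by have := stable_lamX stC erefl kK; rewrite (malcev_seq_swap p q).
(* This right support persists, because every later term ends in an earlier one. *)
pose R := lamX (u 0%N) @: Y.
have xyR k : (k <= K)%N -> lamX (malcev_seq p q u k).1 @: R = Y /\
    lamX (malcev_seq p q u k).2 @: R = Y.
  elim: k => [_|k IH kK]; first exact: uY (ltnW K2).
  have [xR yR] := IH (ltnW kK); have [xu yu] := uY k kK.
  by rewrite malcev_seqS !lamX_mul_imset xR yR.
have cR : sig_closed s R by apply/sig_closed_lamX.
have [|h [h' [hR hY e1 e2]]] := JP Y R cR.
  by exists (u 0%N); split=> //; apply: (stable_divisors st) (ltnW K2).
have [_ _ _ H4] := hd.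
have [_ canc] := H4 Y Y0 (not_A_ge_aY cY).
apply: (stable_malcev_eq cY hR hY e1 e2 st) => //.
- move=> k kK; have [xu _] := uY k kK; have [xR _] := xyR k (ltnW kK).
  by apply: (imset_inj (@lamX_inj _ _ (malcev_seq p q u k).1)); rewrite xu.
- by move=> k /xyR[].
- by move=> k /xyR[].
exact: cP.
Qed.

(* Downward induction on a lower bound i for the number of divisors: either both
   terms eventually get more than i divisors, or the sequence is stable. *)
Lemma malcev_nilpotent_of_local :
  (forall Y, Y != set0 -> ~ M_ge s #|Y|.+1 (mY Y) ->
    malcev_nilpotent (mY_MYY s d Y)) ->
  ~ nilpotency_condition s d -> malcev_nilpotent [set: M]%classic.
Proof.
move=> Hnil nNC; have [K KP] := stable_bound Hnil nNC.
have descent j i : (#|X| < i + j)%N -> exists l, forall p q u,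
    (i <= #|D p|)%N -> (i <= #|D q|)%N ->
    (malcev_seq p q u l).1 = (malcev_seq p q u l).2.
  elim: j i => [|j IH] i ij.
    exists 0%N => p q u ip; rewrite addn0 in ij.
    by have := leq_ltn_trans (max_card [in D p]) (leq_trans ij ip); rewrite ltnn.
  have [|l lP] := IH i.+1; first by rewrite addSnnS.
  exists (K.+1 + l)%N => p q u ip iq.
  set x := fun k => (malcev_seq p q u k).1.
  set y := fun k => (malcev_seq p q u k).2.
  have sub_step k : D (x k) \subset D (x k.+1) /\ D (y k) \subset D (y k.+1).
    by rewrite /x /y malcev_seqS -!mulgA !divisors_mull.
  have card_step k : (#|D (x k)| <= #|D (y k.+1)|)%N /\
      (#|D (y k)| <= #|D (x k.+1)|)%N.
    have C (m n : M) : (#|D n| <= #|D (m * n)%g|)%N.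
      rewrite -(card_imset _ (@lamX_inj _ s m)).
      exact: subset_leq_card (divisors_mulr m n).
    by rewrite /x /y malcev_seqS; split; apply: C.
  have sub k k' : (k <= k')%N ->
      D (x k) \subset D (x k') /\ D (y k) \subset D (y k').
    move=> /subnKC <-; elim: (k' - k)%N => [|r [sx sy]]; first by rewrite addn0.
    have [sx' sy'] := sub_step (k + r)%N.
    by rewrite addnS (subset_trans sx) ?(subset_trans sy).
  have [/andP[ix iy]|small] := boolP ((i < #|D (x K.+1)|) && (i < #|D (y K.+1)|))%N.
    by rewrite malcev_seqD; apply: lP.
  (* One of the terms at index [K.+1] has at most [i] divisors. By [card_step] this bounds both
     terms at every index up to [K], hence the one extra step. *)
  have le_i k : (k <= K)%N -> (#|D (x k)| <= i)%N /\ (#|D (y k)| <= i)%N.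
    move=> kK; have [/subset_leq_card sx /subset_leq_card sy] := sub k.+1 K.+1 kK.
    have [/subset_leq_card sx' /subset_leq_card sy'] := sub_step k.
    have [cx cy] := card_step k.
    by move: small sx sy sx' sy' cx cy; lia.
  have st : stable p q u K (D p) (D q).
    move=> k kK; have [sx sy] := sub 0%N k (leq0n k); have [kx ky] := le_i k kK.
    split; apply/esym/eqP; rewrite eqEcard ?sx ?sy /=.
      exact: leq_trans ip.
    exact: leq_trans iq.
  apply: (malcev_seq_eq (leq_trans (leqnSn K) (leq_addr l K.+1))).
  apply: KP st _; have [px qx] := le_i 0%N (leq0n K).
  by apply/eqP; rewrite eqn_leq (leq_trans px iq) (leq_trans qx ip).
have [l lP] := descent #|X|.+1 0%N (leqnn _).
by exists l => p q u _ _ _; apply: lP.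
Qed.

End Exponent.

Theorem theorem3p7 (X : finType) (s : ybe_solution X) (d : nat)
    (hd : admissible_exponent s d) :
  (malcev_nilpotent [set: structure_monoid s]%classic <->
     (forall S : set (structure_monoid s),
        subsemigroup S -> cancellative S -> malcev_nilpotent S) /\
     ~ nilpotency_condition s d) /\
  (malcev_nilpotent [set: structure_monoid s]%classic <->
     (forall Y : {set X}, Y != finset.set0 -> ~ M_ge s #|Y|.+1 (mY s d Y) ->
        malcev_nilpotent (mY_MYY s d Y)) /\
     ~ nilpotency_condition s d).
Proof.
have sub (S : set (structure_monoid s)) :
    malcev_nilpotent [set: structure_monoid s]%classic -> malcev_nilpotent S.
  exact: malcev_nilpotent_sub.
split; split=> [nil|[H nNC]].
- by split; [move=> S _ _; apply: sub | apply: (malcev_nilpotent_not_NC hd)].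
(* Admissibility of [d] makes each of the local semigroups a cancellative subsemigroup, so [H]
   covers it. *)
- apply: (malcev_nilpotent_of_local hd) => // Y Y0 nY.
  have [_ _ _ H4] := hd; have [] := H4 Y Y0; last exact: H.
  by move: nY; rewrite /M_ge cocycle_mY.
- by split; [move=> Y _ _; apply: sub | apply: (malcev_nilpotent_not_NC hd)].
exact: (malcev_nilpotent_of_local hd).
Qed.
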